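(* Let $m\ge 1$ and $n\ge 0$ be integers. There is a bijection between $\mathcal{D}^{\mathfrak{M}^m}(n)$ and the set of partitions of the vertex set of a labeled convex $(2n)$-gon into blocks of even size at most $2m$ whose convex hulls are pairwise disjoint. Moreover, for $n\ge 1$ the cardinality of both sets is $$\sum_{p=0}^{\lceil n/m\rceil-1}\frac{(-1)^p}{n-mp}\binom{n-mp}{p}\binom{3n-mp-p}{n-mp-1}.$$
   Context: A Dyck path of length $2n$ is a word in the letters $U,D$ with $n$ letters of each kind such that every prefix contains at least as many $U$'s as $D$'s. A $k$-ascent of a Dyck path is a maximal block of $k$ consecutive letters $U$. $\mathcal{M}^m(k)$ denotes the set of Dyck paths of length $2k$ all of whose ascents have length at most $m$ ($\mathcal{M}^m(0)$ contains only the empty path). $\mathcal{D}^{\mathfrak{M}^m}(n)$ is the set of Dyck paths $P$ of length $2n$ together with an assignment, to each ascent of $P$ of length $k$, of an element of $\mathcal{M}^m(k)$ (its colour); two such objects are equal iff the underlying path and all colours agree. The vertices of the $(2n)$-gon are labeled (distinguishable), so partitions are counted as set partitions of the labeled vertex set. *)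

(* Defs.v *)
From HB Require Import structures.
From mathcomp Require Import all_boot all_order all_algebra.
From mathcomp Require Import boolp classical_sets reals convex.

Set Implicit Arguments.
Unset Strict Implicit.
Unset Printing Implicit Defensive.

Import Order.TTheory GRing.Theory Num.Theory.

Local Open Scope ring_scope.

Definition letter := bool.
Definition U : letter := true.
Definition D : letter := false.

Definition is_dyck (n : nat) (w : seq letter) : bool :=
  [&& count_mem U w == n, count_mem D w == n &
      [forall i : 'I_(size w).+1,
         (count_mem D (take i w) <= count_mem U (take i w))%N]].

(* The letters at positions i, ..., i + k - 1 form a maximal block of k >= 1
   letters U; the default D of last and head accounts for blocks at either end
   of the word. *)
Definition is_ascent (w : seq letter) (i k : nat) : bool :=
  [&& (0 < k)%N, take k (drop i w) == nseq k U,
      last D (take i w) == D & head D (drop (i + k) w) == D].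

(* An ascent is recorded as the pair (position, length). *)
Definition ascent (w : seq letter) : finType :=
  {a : 'I_(size w) * 'I_(size w).+1 | is_ascent w a.1 a.2}.

Definition ascent_length (w : seq letter) (a : ascent w) : nat := (val a).2.

Definition dyck (n : nat) : finType :=
  {w : (2 * n).-tuple letter | is_dyck n w}.

Definition restricted_dyck (m k : nat) : finType :=
  {w : (2 * k).-tuple letter |
    is_dyck k w && [forall a : ascent w, (ascent_length a <= m)%N]}.

Definition coloured_dyck (m n : nat) : finType :=
  {P : dyck n &
    {dffun forall a : ascent (val P), restricted_dyck m (ascent_length a)}}.

Definition convex_hull (R : realType) (A : set 'rV[R]_2) : set 'rV[R]_2 :=
  smallest (@convex_set R 'rV[R]_2) A.

(* Twice the signed area of the triangle a b c. *)
Definition orientation (R : realType) (a b c : 'rV[R]_2) : R :=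
  (b 0 0 - a 0 0) * (c 0 1 - a 0 1) - (b 0 1 - a 0 1) * (c 0 0 - a 0 0).

(* v lists the vertices of a convex N-gon in cyclic order (in either sense):
   all the other vertices lie strictly on one side of the line through
   each side.  For N = 2 this is a pair of distinct points, and for N = 0 the
   condition is void. *)
Definition convex_polygon (R : realType) (N : nat) (v : 'I_N -> 'rV[R]_2) :
    Prop :=
  injective v /\
  forall i : 'I_N,
    (forall k : 'I_N, k != i -> k != ordS i ->
       0 < orientation (v i) (v (ordS i)) (v k)) \/
    (forall k : 'I_N, k != i -> k != ordS i ->
       orientation (v i) (v (ordS i)) (v k) < 0).

Definition hulls_disjoint (R : realType) (N : nat) (v : 'I_N -> 'rV[R]_2)
    (P : {set {set 'I_N}}) : Prop :=
  forall A B : {set 'I_N}, A \in P -> B \in P -> A != B ->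
    (convex_hull (v @` [set` A]) `&` convex_hull (v @` [set` B]) = set0)%classic.

(* Vertices are identified with their labels in 'I_(2 * n). *)
Definition polygon_partition (R : realType) (m n : nat)
    (v : 'I_(2 * n) -> 'rV[R]_2) : finType :=
  {P : {set {set 'I_(2 * n)}} |
    [&& finset.partition P (finset.setTfor 'I_(2 * n)),
        [forall B in P, ~~ odd #|B| && (#|B| <= 2 * m)%N] &
        `[< hulls_disjoint v P >]]}.

(* Main.v *)
Require Import Defs.
From HB Require Import structures.
From mathcomp Require Import all_boot all_order all_algebra.
From mathcomp Require Import boolp classical_sets reals convex.
From mathcomp Require Import interval_inference zify ring lra.
(* Imported last so that the finset names take precedence over the homonymous
   ones of classical_sets. *)
From mathcomp Require Import fintype finset.

(* Both sets are counted by paths: let passages w L h be the weighted number of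
   paths with steps k - 1 (k >= 0, of weight w k) going from height h to a first
   visit of 0 at time L.  A step-by-step induction gives the Lagrange-type
   formula L * passages w L h = h * [t^(L - h)] p(t)^L, where p is the generating
   polynomial of w.

   Reading the letters of a Dyck path as (ascent, D) pairs, the Dyck paths of
   length 2n weighted by their ascent lengths are counted by
   passages w n.+1 1.  Take first w k = [k <= m], then w k = #|M^m(k)|: since a
   first passage from j splits into j first passages from 1, the two
   applications of the formula combine to [t^n] phi^(2n+1) / (2n+1), with
   phi = 1 + t + ... + t^m.

   Hulls of blocks are disjoint iff the blocks do not cross.  Noncrossing
   partitions of {j, ..., N - 1} are matched with those of {j + 1, ..., N - 1}
   by merging the blocks of j and j + 1 and deleting j, which removes one step
   of a path: weighted by block sizes, the noncrossing partitions of N points are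
   counted by passages w N.+1 1.  Restricting to even sizes at most 2m replaces
   phi(t) by phi(t^2), and [t^(2n)] phi(t^2)^(2n+1) = [t^n] phi^(2n+1).  So the
   two sets are equinumerous, and expanding (1 - t^(m+1))^(2n+1) / (1 - t)^(2n+1)
   gives the sum. *)

Set Implicit Arguments.
Unset Strict Implicit.
Unset Printing Implicit Defensive.

Import Order.TTheory GRing.Theory Num.Theory.

(** * First passages *)

(** The sum may stop at [k = L']: a step descends by at most one, so a path whose height exceeds the
    remaining time never reaches 0. *)
Fixpoint passages (w : nat -> nat) (L h : nat) : nat :=
  match L, h with
  | 0, _ => h == 0
  | L'.+1, 0 => 0
  | L'.+1, h'.+1 => \sum_(0 <= k < L) w k * passages w L' (h' + k)
  end.
Arguments passages : simpl never.

Lemma passages0 w L : passages w L.+1 0 = 0.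
Proof. by []. Qed.

Lemma passagesS w L h :
  passages w L.+1 h.+1 = \sum_(0 <= k < L.+1) w k * passages w L (h + k).
Proof. by []. Qed.

Lemma passages_gt w L h : L < h -> passages w L h = 0.
Proof.
elim: L h => [|L IH] [|h] //; rewrite ltnS => lt; rewrite passagesS.
by apply: big1_seq => k _; rewrite IH ?muln0 //; lia.
Qed.

(** The terms with [h + k > L] vanish, so any cut-off [K >= L - h] will do. This aligns the bounds
    of sums that are exchanged or compared. *)
Lemma passagesSE w L h K : L <= h + K ->
  passages w L.+1 h.+1 = \sum_(0 <= k < K.+1) w k * passages w L (h + k).
Proof.
move=> le; rewrite passagesS.
have key b b' : L <= h + b -> b <= b' ->
  \sum_(0 <= k < b'.+1) w k * passages w L (h + k) =
  \sum_(0 <= k < b.+1) w k * passages w L (h + k).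
  move=> le1 le2; rewrite (@big_cat_nat _ _ _ b.+1) //= [X in _ + X]big_nat_cond.
  rewrite [X in _ + X]big1 ?addn0 // => k /andP[/andP[h1 h2] _].
  by rewrite passages_gt ?muln0 //; lia.
by case: (leqP K L) => ?; [rewrite (key K L)|rewrite -(key L K)] => //; lia.
Qed.

(* A first passage from [h + g] down to 0 first passes through [g]. *)
Lemma passagesD w L h g :
  passages w L (h + g) =
  \sum_(0 <= a < L.+1) passages w a h * passages w (L - a) g.
Proof.
elim: L h g => [|L IH] h g.
  by rewrite big_nat1 subn0 /=; case: h => //=; rewrite mul1n.
rewrite big_ltn // subn0; case: h => [|h].
  by rewrite add0n mul1n big_add1 /= (big1_seq (op := addn)) ?addn0.
rewrite addSn !passagesS mul0n add0n big_add1.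
under eq_big_nat => k _ do rewrite addnAC IH big_distrr /=.
rewrite exchange_big /=; apply: eq_big_nat => a /andP[_ lea].
rewrite (@passagesSE _ a h L); last by lia.
rewrite big_distrl /= subSS; apply: eq_bigr => k _; by rewrite mulnA.
Qed.

Local Open Scope ring_scope.

Lemma passages_coef (F : numFieldType) (w : nat -> nat) (p : {poly F}) L h :
  (forall k, (k < L)%N -> p`_k = (w k)%:R) -> (h <= L)%N ->
  L%:R * (passages w L h)%:R = h%:R * (p ^+ L)`_(L - h).
Proof.
elim: L h => [|L IH] [|h] // ep leL; rewrite ?mul0r ?mulr0 //.
(* A single step is treated apart: the argument below cancels [M], the time left after the first
   step, which must be nonzero. *)
case: L => [|L] in IH ep leL *.
  move: leL; case: h => // _; rewrite passagesS big_nat1 /= muln1 expr1.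
  by rewrite subnn ep.
set M := L.+1 in IH ep leL *.
have M0 : M%:R != 0 :> F by rewrite pnatr_eq0.
apply: (mulfI M0); rewrite (passagesSE w (K := (M - h)%N)); last by lia.
rewrite natr_sum mulrCA mulr_sumr.
(* By induction each summand is [p_k (h + k) [t^(M - h - k)] p^M]. The part with [h] sums to a
   coefficient of [p^(M+1)], the part with [k] to one of [t p' p^M]. *)
have -> : \sum_(0 <= k < (M - h).+1) M%:R * (w k * passages w M (h + k))%N%:R =
  h%:R * (p ^+ M.+1)`_(M - h) + (p^`() * p ^+ M * 'X)`_(M - h).
  rewrite exprS coefM mulr_sumr big_mkord -mulrA coefM.
  have -> : \sum_(j < (M - h).+1) p^`()`_j * (p ^+ M * 'X)`_(M - h - j) =
     \sum_(j < (M - h).+1) p`_j *+ j * (p ^+ M)`_(M - h - j).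
    rewrite [LHS]big_ord_recr /= subnn coefMX /= mulr0 addr0.
    rewrite [RHS]big_ord_recl /= mulr0n mul0r add0r.
    apply: eq_bigr => i _ ; rewrite coef_deriv coefMX /bump /= add1n.
    have -> : (M - h - i == 0)%N = false by have := ltn_ord i; lia.
    by congr (_ * _`__); lia.
  rewrite -big_split /=; apply: eq_bigr => k _.
  have ltk := ltn_ord k.
  rewrite natrM mulrCA IH; last by lia.
  - rewrite -ep; last by lia.
    rewrite natrD subnDA -[p`_k *+ k]mulr_natr; ring.
  - by move=> i lti; apply: ep; lia.
rewrite coefMX.
(* As [(M + 1) p' p^M] is the derivative of [p^(M+1)], the total factor is [h + (M - h) / (M + 1) =
   M (h + 1) / (M + 1)]. *)
have := congr1 (fun q : {poly F} => q`_((M - h).-1)) (deriv_exp p M.+1).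
rewrite coef_deriv coefMn /=.
case: eqVneq => [e|ne].
  have -> : M = h by lia.
  by rewrite subSS subnn => _; ring.
have -> : (M - h).-1.+1 = (M - h)%N by lia.
rewrite subSS => e; rewrite -[LHS]mulr_natr -[RHS]mulr_natr in e.
rewrite mulrDr [M.+1%:R * _`_ _.-1]mulrC -e natrB; last by lia.
rewrite -[M.+1]addn1 -[h.+1]addn1 !natrD; ring.
Qed.

(** A first passage from [j] is a chain of [j] first passages from 1. The index of [p] leaves out
    one step of each, whence the time [i + j]. *)
Lemma coef_exp_passages (F : numFieldType) w (p : {poly F}) n j i :
  (forall k, (k <= n)%N -> p`_k = (passages w k.+1 1)%:R) -> (i <= n)%N ->
  (p ^+ j)`_i = (passages w (i + j) j)%:R.
Proof.
move=> ep; elim: j i => [|j IH] i lei.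
  by rewrite expr0 coef1 addn0; case: i {lei}.
rewrite exprS coefM addnS -[X in passages _ _ X]add1n passagesD.
(* The first piece takes a time [a >= 1], and [a <= i.+1] because the other pieces need time at
   least [j]. *)
rewrite big_ltn // passages_gt // mul0n add0n big_add1 /= -addnS.
rewrite (@big_cat_nat _ _ _ i.+1) //=; last by lia.
rewrite [X in (_ + X)%N]big_nat_cond [X in (_ + X)%N]big1 ?addn0; last first.
  move=> k /andP[/andP[h1 h2] _].
  by rewrite (@passages_gt _ (_ - _)) ?muln0 //; lia.
rewrite natr_sum big_mkord; apply: eq_bigr => k _; have ltk := ltn_ord k.
rewrite ep; last by lia.
rewrite IH ?natrM; last by lia.
by congr (_ * (passages _ _ _)%:R); lia.
Qed.

(* The right-hand side is the product of [r] with the binomial series of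
   [(1 - 'X) ^- q]. *)
Lemma coef_mul_exp1BX (F : comNzRingType) q (g r : {poly F}) n :
  (1 - 'X) ^+ q * g = r ->
  g`_n = \sum_(0 <= i < n.+1) r`_i * ('C(n - i + q - 1, n - i))%:R.
Proof.
elim: q g n => [|q IH] g n e.
  (* For [q = 0] the binomials vanish when [i < n]; when [i = n], truncated subtraction gives
     ['C(0, 0) = 1]. *)
  rewrite big_nat_recr //= subnn addn0 bin0 mulr1 -e mul1r big_nat_cond.
  rewrite big1 ?add0r // => i /andP[/andP[_ lti] _].
  by rewrite addn0 bin_small ?mulr0 //; lia.
have rec k : ((1 - 'X) * g)`_k =
    \sum_(0 <= i < k.+1) r`_i * ('C(k - i + q - 1, k - i))%:R.
  by apply: IH; rewrite mulrA -exprSr.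
have recE k : ((1 - 'X) * g)`_k = g`_k - (if k == 0%N then 0 else g`_k.-1).
  by rewrite mulrBl mul1r coefB coefXM.
elim: n => [|n IHn].
  have := rec 0%N; rewrite recE /= subr0 => ->.
  by rewrite !big_nat1 !subnn !bin0.
(* Dividing by one more factor [1 - 'X] takes partial sums, and Pascal's rule evaluates them. *)
have := rec n.+1; rewrite recE /= => /eqP; rewrite subr_eq => /eqP ->.
rewrite IHn [in LHS]big_nat_recr // [in RHS]big_nat_recr //= addrAC.
rewrite subnn !bin0 -big_split /=; congr (_ + _).
apply: eq_big_nat => i /andP[_ lti]; rewrite -mulrDr -natrD; congr (_ * _%:R).
rewrite subSn; last by lia.
by rewrite addSn subSS subn0 !addnS !subSS !subn0 -binS.
Qed.

Lemma coef_exp_geometric m n q :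
  ((\poly_(k < m.+1) (1 : rat)) ^+ q)`_n =
  \sum_(0 <= j < q.+1) (-1) ^+ j * ('C(q, j))%:R *
    (if (m.+1 * j <= n)%N
     then ('C(n - m.+1 * j + q - 1, n - m.+1 * j))%:R else 0).
Proof.
set phi := \poly_(k < _) _.
have ephi : (1 - 'X) * phi = 1 - 'X^(m.+1).
  rewrite /phi poly_def -[RHS]opprB subrX1 -mulNr opprB; congr (_ * _).
  by apply: eq_bigr => i _; rewrite scale1r.
have e : (1 - 'X) ^+ q * phi ^+ q = (1 - 'X^(m.+1)) ^+ q.
  by rewrite -exprMn ephi.
rewrite (coef_mul_exp1BX n e).
have er i : ((1 - 'X^(m.+1) : {poly rat}) ^+ q)`_i =
   \sum_(0 <= j < q.+1) (-1) ^+ j * ('C(q, j))%:R * (i == (m.+1 * j)%N)%:R.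
  rewrite exprBn coef_sum big_mkord; apply: eq_bigr => j _.
  have -> : (-1) ^+ j = ((-1) ^+ j)%:P :> {poly rat} by rewrite polyC_exp polyCN.
  rewrite expr1n mulr1 -exprM coefMn coefCM coefXn.
  by rewrite -[LHS]mulr_natr mulrAC.
under eq_bigr => i _ do rewrite er mulr_suml.
rewrite exchange_big /=; apply: eq_bigr => j _.
rewrite (eq_bigr (fun i => (-1) ^+ j * ('C(q, j))%:R *
  ((i == (m.+1 * j)%N)%:R * ('C(n - i + q - 1, n - i))%:R))); last first.
  by move=> i _; rewrite mulrA.
rewrite -mulr_sumr; congr (_ * _).
case: leqP => h.
  rewrite (bigD1_seq (m.+1 * j)%N) ?mem_index_iota ?iota_uniq //= eqxx mul1r.
  by rewrite big1 ?addr0 // => i /negPf ->; rewrite mul0r.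
rewrite big_nat_cond big1 // => i /andP[/andP[_ hi] _].
by case: eqP => [ei|]; rewrite ?mul0r //; lia.
Qed.

(** With [a = n - m * p] and [q = 2 * n - p] this carries the [p]-th term of the expansion of
    [(1 + t + ... + t^m)^(2n+1)] into [2n + 1] times the [p]-th term of the stated sum. Clearing all
    factorials proves it. *)
Lemma bin_ratio a p q : (0 < a)%N -> (p <= a)%N ->
  ((q + p).+1 * ('C(a, p) * 'C(a + q, a - 1)) =
   a * ('C((q + p).+1, p) * 'C(a + q, a - p)))%N.
Proof.
case: a => // a _ le; rewrite subn1 /=.
have e1 := bin_fact le.
have /bin_fact e2 : (a <= a.+1 + q)%N by lia.
have /bin_fact e3 : (p <= (q + p).+1)%N by lia.
have /bin_fact e4 : (a.+1 - p <= a.+1 + q)%N by lia.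
have {}e2 : ('C(a.+1 + q, a) * (a`! * (q.+1)`!) = (a.+1 + q)`!)%N.
  by rewrite -e2; congr (_ * (_ * _`!))%N; lia.
have {}e3 : ('C((q + p).+1, p) * (p`! * (q.+1)`!) = ((q + p).+1)`!)%N.
  by rewrite -e3; congr (_ * (_ * _`!))%N; lia.
have {}e4 : ('C(a.+1 + q, a.+1 - p) * ((a.+1 - p)`! * (q + p)`!) = (a.+1 + q)`!)%N.
  by rewrite -e4; congr (_ * (_ * _`!))%N; lia.
have P k : (0 < k`!)%N := fact_gt0 k.
apply/eqP; rewrite -(eqn_pmul2r (P p)) -(eqn_pmul2r (P (a.+1 - p)%N)).
rewrite -(eqn_pmul2r (P a)) -(eqn_pmul2r (P q.+1)) -(eqn_pmul2r (P (q + p)%N)).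
apply/eqP; rewrite factS in e1 e3.
transitivity ((q + p).+1 * ('C(a.+1, p) * (p`! * (a.+1 - p)`!)) *
   ('C(a.+1 + q, a) * (a`! * (q.+1)`!)) * (q + p)`!)%N; first by ring.
rewrite e1 e2 -e4.
transitivity (a.+1 * a`! * ('C((q + p).+1, p) * (p`! * (q.+1)`!)) *
  ('C(a.+1 + q, a.+1 - p) * ((a.+1 - p)`! * (q + p)`!)))%N; last by ring.
rewrite e3 ?factS; ring.
Qed.

Lemma coef_exp_geometric_sum m n : (0 < m)%N -> (0 < n)%N ->
  ((\poly_(k < m.+1) (1 : rat)) ^+ (2 * n).+1)`_n =
  (2 * n).+1%:R *
  \sum_(0 <= p < `|Num.ceil (n%:R / m%:R : rat)|)
     (-1) ^+ p / (n - m * p)%:R * ('C(n - m * p, p))%:R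
       * ('C(3 * n - m * p - p, n - m * p - 1))%:R.
Proof.
move=> m0 n0; set E := `|_|%N.
(* [E] is the ceiling of [n / m], the least [k] with [n <= m * k]. *)
have ceilE k : (E <= k)%N = (n <= m * k)%N.
  have c0 : 0 < Num.ceil (n%:R / m%:R : rat).
    by rewrite ceil_gt0 divr_gt0 // ltr0n.
  rewrite leqNgt [RHS]leqNgt; congr (~~ _).
  have -> : (k < E)%N = (k%:Z < Num.ceil (n%:R / m%:R : rat)).
    by rewrite /E -ltz_nat abszE gtr0_norm.
  by rewrite ceil_gt_int -pmulrn ltr_pdivlMr ?ltr0n // -natrM ltr_nat mulnC.
have En : (E <= n.+1)%N by rewrite ceilE; nia.
rewrite coef_exp_geometric mulr_sumr.
rewrite (@big_cat_nat _ _ _ n.+1) //=; last by lia.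
rewrite [X in _ + X]big_nat_cond [X in _ + X]big1 ?addr0; last first.
  move=> k /andP[/andP[h1 h2] _]; case: leqP => h; last by rewrite mulr0.
  nia.
pose f p : rat := (2 * n).+1%:R * ((-1) ^+ p / (n - m * p)%:R *
  ('C(n - m * p, p))%:R * ('C(3 * n - m * p - p, n - m * p - 1))%:R).
rewrite [RHS](_ : _ = \sum_(0 <= p < E) f p) //.
(* From [E] on, the natural number [n - m * p] is 0 and its inverse in [rat] is 0 by convention, so
   the sum extends to [p <= n]. *)
have -> : \sum_(0 <= p < E) f p = \sum_(0 <= p < n.+1) f p.
  rewrite [RHS](@big_cat_nat _ _ _ E) //=.
  rewrite [X in _ + X]big_nat_cond [X in _ + X]big1 ?addr0 //.
  move=> k /andP[/andP[h1 _] _]; rewrite ceilE -subn_eq0 in h1.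
  by rewrite /f (eqP h1) invr0 mulr0 !mul0r mulr0.
apply: eq_big_nat => p /andP[_ ltp]; rewrite /f.
case: leqP => h; last first.
  by rewrite (@bin_small (n - m * p)%N p) ?mulr0 ?mul0r ?mulr0 //; lia.
have a0 : (0 < n - m * p)%N by nia.
have /(@bin_ratio _ p (2 * n - p)%N a0) : (p <= n - m * p)%N by lia.
have -> : (2 * n - p + p = 2 * n)%N by lia.
have -> : (n - m * p + (2 * n - p) = 3 * n - m * p - p)%N by lia.
have -> : (n - m.+1 * p + (2 * n).+1 - 1 = 3 * n - m * p - p)%N by lia.
have -> : (n - m.+1 * p = n - m * p - p)%N by lia.
move/(congr1 (fun k : nat => k%:R : rat)); rewrite !natrM => e.
have an0 : (n - m * p)%:R != 0 :> rat by rewrite pnatr_eq0 -lt0n.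
apply: (mulfI an0).
transitivity ((-1) ^+ p *
   ((n - m * p)%:R * (('C((2 * n).+1, p))%:R *
     ('C(3 * n - m * p - p, n - m * p - p))%:R)) : rat); first by ring.
by rewrite -e; field.
Qed.

Local Close Scope ring_scope.

(** * Dyck paths *)

Lemma big_sig_val (R : Type) (idx : R) (op : Monoid.com_law idx) (T : finType)
    (P : pred T) (F : T -> R) :
  \big[op/idx]_(x : {x : T | P x}) F (val x) = \big[op/idx]_(x | P x) F x.
Proof. exact: esym (big_sub (P : {pred T}) F). Qed.

(* [runs w r s] is the product of [w k] over the lengths [k] of the ascents of
   [nseq r U ++ s] (including k = 0 if a run is empty). *)
Fixpoint runs (w : nat -> nat) (r : nat) (s : seq letter) : nat :=
  match s with
  | [::] => w r
  | b :: s' => if b then runs w r.+1 s' else w r * runs w 0 s'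
  end.

(** Length of the ascent starting at position [i], and 0 if none starts there. The letter [b] stands
    for the one before [s], which allows recursion on suffixes. *)
Definition ascent_at (b : letter) (s : seq letter) (i : nat) : nat :=
  if last b (take i s) == D then index D (drop i s) else 0.

Lemma is_ascent_at s i k :
  is_ascent s i k = (0 < k) && (k == ascent_at D s i).
Proof.
rewrite /is_ascent /ascent_at; case: posnP => //= k0; rewrite andbCA.
case: (last D _ =P D) => _ /=; last by case: k k0.
rewrite addnC -drop_drop; move: (drop i s) => {i}t {k0}.
elim: t k => [|c t IH] [|k] //=; first by case: c.
by case: c; rewrite /= ?andbF //= eqseq_cons ?eqxx ?eqSS -?IH.
Qed.

(** The product is taken over all positions instead: by [w 0 = 1], positions where no ascent starts
    and empty runs contribute 1. *)
Lemma prod_ascent_runs w s : w 0 = 1 ->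
  \prod_(a : ascent s) w (ascent_length a) = runs w 0 s.
Proof.
move=> w0.
transitivity (\prod_(0 <= i < size s) w (ascent_at D s i)).
  rewrite (big_sig_val _ (fun a : 'I_(size s) * 'I_(size s).+1 => is_ascent s a.1 a.2)
    (fun a => w a.2)).
  rewrite -(pair_big_dep xpredT (fun (i : 'I_(size s)) (k : 'I_(size s).+1) =>
    is_ascent s i k) (fun _ k => w k)) /= big_mkord.
  apply: eq_bigr => i _.
  have lt : ascent_at D s i < (size s).+1.
    rewrite /ascent_at; case: ifP => // _; rewrite ltnS.
    by apply: leq_trans (index_size _ _) _; rewrite size_drop leq_subr.
  case: (posnP (ascent_at D s i)) => [e|gt0].
    rewrite e w0 big1 // => k; rewrite is_ascent_at e.
    by case: (nat_of_ord k).
  rewrite (big_pred1 (Ordinal lt)) // => k /=.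
  rewrite is_ascent_at -val_eqE /=; case: eqP => [->|]; rewrite ?andbF //.
  by rewrite gt0.
have step b c t : \prod_(0 <= i < size (c :: t)) w (ascent_at b (c :: t) i) =
    (if b == D then w (index D (c :: t)) else 1) *
    \prod_(0 <= i < size t) w (ascent_at c t i).
  by rewrite /= big_nat_recl //= /ascent_at /=; case: eqP => // _; rewrite w0.
(* The induction needs both preceding letters: after [U] an ascent with [r] letters read is open and
   has [index D s] letters to come; after [D] none is open. *)
suff H : (forall r, runs w r s =
      w (r + index D s) * \prod_(0 <= i < size s) w (ascent_at U s i)) /\
    runs w 0 s = \prod_(0 <= i < size s) w (ascent_at D s i) by case: H.
elim: s => [|c s [IHU IHD]]; first by split=> [r|]; rewrite /= big_nil ?muln1 ?addn0.
split=> [r|]; rewrite step /=.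
  by case: c; rewrite /= mul1n; [rewrite IHU addnS|rewrite addn0 IHD].
by case: c; rewrite /= ?w0; [rewrite IHU add1n|rewrite IHD].
Qed.

Fixpoint dyck_from (h : nat) (s : seq letter) : bool :=
  match s with
  | [::] => h == 0
  | b :: s' => if b then dyck_from h.+1 s' else (0 < h) && dyck_from h.-1 s'
  end.

Lemma dyck_fromP h s :
  reflect (count_mem D s = h + count_mem U s /\
    forall i, count_mem D (take i s) <= h + count_mem U (take i s))
    (dyck_from h s).
Proof.
elim: s h => [|c s IH] h /=.
  by apply: (iffP eqP) => [->|[]]; rewrite ?addn0.
case: c; rewrite /= ?add0n.
  apply: (iffP (IH _)) => -[e p].
    split; first by rewrite e addnCA addnA.
    by case=> [|i] //=; have := p i; rewrite add0n addnCA addnA.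
  split; first by rewrite e addnCA addnA.
  by move=> i; have := p i.+1; rewrite /= add0n addnCA addnA.
case: h => [|h] /=.
  apply: ReflectF => -[_ /(_ 1)]; by rewrite /= take0.
apply: (iffP (IH _)) => -[e p].
  split; first by rewrite e.
  by case=> [|i] //=; have := p i; rewrite add1n add0n addSn ltnS.
split; first by move: e; rewrite add1n addSn => -[].
by move=> i; have := p i.+1; rewrite /= add1n add0n addSn ltnS.
Qed.

Lemma count_UD (s : seq letter) : count_mem U s + count_mem D s = size s.
Proof. by elim: s => [|[] s IH] //=; rewrite -IH ?add0n ?add1n ?addnS ?addSn. Qed.

Lemma is_dyck_from n (s : (2 * n).-tuple letter) : is_dyck n s = dyck_from 0 s.
Proof.
apply/and3P/dyck_fromP => [[/eqP eU /eqP eD /forallP p]|[e p]].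
  split=> [|i]; first by rewrite eU eD.
  case: (ltnP i (size s).+1) => [lti|/ltnW lei]; first exact: p (Ordinal lti).
  by rewrite take_oversize ?eU ?eD.
have := count_UD s; rewrite size_tuple. rewrite e => e2.
split; [by apply/eqP; lia|by apply/eqP; lia|].
by apply/forallP => i; exact: p.
Qed.

Lemma dyck_from_size h s : dyck_from h s -> h <= size s.
Proof. by case/dyck_fromP => e _; have := count_UD s; lia. Qed.

(** Here [d] is the number of letters [D] left and [r] the length of the open run. Once this run has
    grown by [k], the rest is [d] groups, each a [D] and a possibly empty run of [U]: these are the
    steps of the passage from [h + k]. Positive height before each [D] is the first-visit
    condition. *)
Lemma sum_dyck_runs w L : forall d h r, h <= d -> L + h = 2 * d ->
  \sum_(s : L.-tuple letter | dyck_from h s) runs w r s =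
  \sum_(0 <= k < (d - h).+1) w (r + k) * passages w d (h + k).
Proof.
elim: L => [|L IH] d h r hd eL.
  have [-> ->] : d = 0 /\ h = 0 by lia.
  rewrite big_nat1 addn0 muln1 (big_pred1 [tuple]) //.
  by move=> t; rewrite (tuple0 t); apply/esym/eqP.
have -> : \sum_(s : L.+1.-tuple letter | dyck_from h s) runs w r s =
    \sum_(t : L.-tuple letter | dyck_from h.+1 t) runs w r.+1 t +
    \sum_(t : L.-tuple letter | (0 < h) && dyck_from h.-1 t) w r * runs w 0 t.
  rewrite (reindex (fun p : letter * L.-tuple letter => [tuple of p.1 :: p.2])).
    rewrite -(pair_big_dep xpredT (fun b (t : L.-tuple letter) =>
      dyck_from h (b :: t)) (fun b t => runs w r (b :: t))) /=.
    by rewrite /letter big_bool.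
  exists (fun t : L.+1.-tuple letter => (thead t, [tuple of behead t])).
    by move=> [b t] _ /=; rewrite theadE; congr pair; apply: val_inj.
  by move=> t _; rewrite [RHS]tuple_eta; apply: val_inj.
have eU : \sum_(t : L.-tuple letter | dyck_from h.+1 t) runs w r.+1 t =
    \sum_(0 <= k < d - h) w (r + k.+1) * passages w d (h + k.+1).
  case: (ltnP h d) => lthd.
    rewrite (IH d) //; last by lia.
    have -> : (d - h.+1).+1 = d - h by lia.
    by apply: eq_bigr => k _; rewrite !addnS !addSn.
  (* Here [h = d], so all remaining letters are [D] and none can be [U]. *)
  rewrite big1; last first.
    by move=> t /dyck_from_size; rewrite size_tuple => ?; lia.
  have -> : d - h = 0 by lia.
  by rewrite big_geq.
rewrite eU big_nat_recl // addnC !addn0; congr (_ + _).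
case: h hd eL {eU} => [|h] hd eL /=.
  by rewrite big_pred0 //; case: d {hd} eL => // d _; rewrite passages0 muln0.
rewrite -big_distrr /=; congr (_ * _); case: d => // d in hd eL *.
rewrite (IH d) //; last by lia.
by rewrite (passagesSE w (K := (d - h))) ?subSS //; lia.
Qed.

(** A [D] put before the first ascent, leading from 1 to 0, explains the start at 1 and the
    additional step. *)
Lemma sum_dyck_ascents w n : w 0 = 1 ->
  \sum_(P : dyck n) \prod_(a : ascent (val P)) w (ascent_length a) =
  passages w n.+1 1.
Proof.
move=> w0; under eq_bigr => P _ do rewrite prod_ascent_runs //.
rewrite (big_sig_val _ (fun s : (2 * n).-tuple letter => is_dyck n s)
  (fun s => runs w 0 s)).
under eq_bigl => s do rewrite is_dyck_from.
rewrite (@sum_dyck_runs _ _ n) //; last by rewrite addn0.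
by rewrite subn0 passagesS; apply: eq_bigr.
Qed.

(** For 0/1 weights the product over ascents is the indicator that every length is at most [m]. *)
Lemma card_restricted_dyck m k :
  #|restricted_dyck m k| = passages (fun i => i <= m) k.+1 1.
Proof.
rewrite -sum_dyck_ascents // (big_sig_val _ (fun s : (2 * k).-tuple letter => is_dyck k s)
  (fun s => \prod_(a : ascent s) (ascent_length a <= m : nat))).
rewrite card_sig -sum1_card big_mkcondr /=.
apply: eq_bigr => s _; case: forallP => [H|H].
  by rewrite big1 // => a _; rewrite H.
have /forallPn[a /negPf na] : ~~ [forall a : ascent s, ascent_length a <= m].
  by apply/forallP.
by rewrite (bigD1 a) //= na mul0n.
Qed.

Lemma card_coloured_dyck m n :
  #|coloured_dyck m n| = passages (fun k => #|restricted_dyck m k|) n.+1 1.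
Proof.
rewrite -sum_dyck_ascents; last first.
  by rewrite card_restricted_dyck passagesS big_nat1.
rewrite card_tagged sumnE big_map big_enum /=; apply: eq_bigr => P _.
by rewrite card_dep_ffun foldrE big_map big_enum.
Qed.

(** * Noncrossing partitions *)

Local Open Scope set_scope.
Local Open Scope nat_scope.

Definition noncrossing (N : nat) (P : {set {set 'I_N}}) : Prop :=
  forall (A B : {set 'I_N}) (a b c d : 'I_N), A \in P -> B \in P ->
    a \in A -> b \in B -> c \in A -> d \in B -> a < b -> b < c -> c < d -> A = B.

Definition nc_partition (N : nat) (E : {set 'I_N}) (P : {set {set 'I_N}}) : bool :=
  partition P E && `[< noncrossing P >].

Lemma nc_partitionP (N : nat) (E : {set 'I_N}) (P : {set {set 'I_N}}) :
  reflect [/\ forall B, B \in P -> B != set0 /\ {subset B <= E},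
     forall x, x \in E -> exists2 B, B \in P & x \in B,
     forall A B x, A \in P -> B \in P -> x \in A -> x \in B -> A = B &
     noncrossing P] (nc_partition E P).
Proof.
apply: (iffP andP) => [[/and3P[/eqP cov tri n0] /asboolP nc]|[sub cov dis nc]].
  split=> // [B BP|x|A B x AP BP xA xB].
  - split; first by apply: contraNneq n0 => <-.
    by move=> x xB; rewrite -cov; apply/bigcupP; exists B.
  - by rewrite -cov => /bigcupP[B]; exists B.
  - by rewrite -(def_pblock tri AP xA) -(def_pblock tri BP xB).
split; last exact/asboolP.
apply/and3P; split.
- apply/eqP/setP => x; apply/bigcupP/idP => [[B BP]|/cov //].
  by case: (sub _ BP) => _; apply.
- apply/trivIsetP => A B AP BP; apply: contraR.
  case/pred0Pn => x /andP[xA xB]; apply/eqP; exact: dis xA xB.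
- by apply/negP => /sub[]; rewrite eqxx.
Qed.

Lemma nc_pblock N (E : {set 'I_N}) P B x :
  nc_partition E P -> B \in P -> x \in B -> pblock P x = B.
Proof. by case/andP => /and3P[_ tri _] _; apply: def_pblock. Qed.

(** The [t] largest elements of [X], or all of [X] if it has fewer. *)
Definition lastn N (t : nat) (X : {set 'I_N}) : {set 'I_N} :=
  [set y in X | #|[set z in X | y < z]| < t].

Lemma lastn_setU N (H L : {set 'I_N}) :
  (forall l h, l \in L -> h \in H -> l < h) -> lastn #|H| (H :|: L) = H.
Proof.
move=> LH; apply/setP => y; rewrite !inE.
have [yH|yH] := boolP (y \in H); rewrite /=.
  rewrite [X in _ < X](cardsD1 y) yH add1n ltnS.
  apply: subset_leq_card; apply/subsetP => z.
  rewrite !inE -val_eqE /= => /andP[/orP[zH|zL] yz]; rewrite ?zH ?andbT; try lia.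
  by have := LH _ _ zL yH; lia.
have [yL|//] := boolP (y \in L); apply/negbTE; rewrite -leqNgt.
apply/subset_leq_card/subsetP => z zH; rewrite !inE zH; exact: LH.
Qed.

Lemma exists_last N (X : {set 'I_N}) t : t <= #|X| ->
  exists H : {set 'I_N}, [/\ H \subset X, #|H| = t &
    forall l h, l \in X :\: H -> h \in H -> l < h].
Proof.
elim: t => [|t IH] lt.
  by exists set0; split; rewrite ?sub0set ?cards0 // => l h _; rewrite inE.
have [H [HX cH lH]] := IH (ltnW lt).
have /card_gt0P[x0 x0D] : 0 < #|X :\: H|.
  by rewrite cardsD (setIidPr HX) cH subn_gt0.
case: (@arg_maxnP _ x0 (fun i => i \in X :\: H) (fun i => i) x0D) => x xD mx.
move: (xD); rewrite inE => /andP[xH xX].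
exists (x |: H); split.
- by rewrite subUset sub1set xX.
- by rewrite cardsU1 xH cH.
- move=> l h; rewrite !inE negb_or -val_eqE /= => /andP[/andP[lx lH'] lX].
  have lD : l \in X :\: H by rewrite inE lH' lX.
  case/orP => [/eqP->|]; last exact: lH.
  by have := mx _ lD; rewrite /=; lia.
Qed.

(* The two blocks [x0 |: H] and [L] of a partition (with [L] empty when x1 lies
   in the block of x0) are merged into the block [H :|: L] of x1. *)
Definition unmerged N (x0 : 'I_N) (H L : {set 'I_N}) (S : {set {set 'I_N}}) :
    {set {set 'I_N}} :=
  ((x0 |: H) |: (L |: S)) :\ set0.

Definition merged N (H L : {set 'I_N}) (S : {set {set 'I_N}}) :
    {set {set 'I_N}} :=
  (H :|: L) |: S.

(** What both sides of the merging share. As [x1] follows [x0], noncrossing puts the rest [H] of the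
    block of [x0] above the block [L] of [x1]; so the merged block and the size of [H] determine [H]
    and [L]. *)
Definition mergeable N (x1 : 'I_N) (H L : {set 'I_N}) (S : {set {set 'I_N}}) :
    Prop :=
  [/\ forall l h, l \in L -> h \in H -> l < h, x1 \in H :|: L,
      forall y, y \in H :|: L -> x1 <= y, set0 \notin S &
      forall B y, B \in S -> y \in B -> x1 < y /\ y \notin H :|: L].

Lemma mergeable_low N (x1 : 'I_N) H L S y :
  mergeable x1 H L S -> y \in L -> x1 \in L.
Proof.
case=> LH x1HL ge _ _ yL; move: x1HL; rewrite inE => /orP[x1H|//].
have := LH _ _ yL x1H; have := ge y; rewrite inE yL orbT => /(_ isT); lia.
Qed.

Lemma in_unmerged N (x0 : 'I_N) H L S B :
  (B \in unmerged x0 H L S) =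
  (B != set0) && [|| B == x0 |: H, B == L | B \in S].
Proof. by rewrite !inE. Qed.

(** A point of the merged block between two points of another block already crosses that block
    before merging: together with [x0] if it lies in [H], with [x1] if it lies in [L]. *)
Lemma merged_nc N (x0 x1 : 'I_N) H L S : x1 = x0.+1 :> nat ->
  mergeable x1 H L S -> nc_partition [set i : 'I_N | x0 <= i] (unmerged x0 H L S) ->
  nc_partition [set i : 'I_N | x1 <= i] (merged H L S).
Proof.
move=> e10 M; have low := mergeable_low M.
case: M => LH x1HL ge S0 Sgt /nc_partitionP[sub cov dis nc].
have SP B : B \in S -> B \in unmerged x0 H L S.
  move=> BS; rewrite in_unmerged BS !orbT andbT.
  by apply: contraNneq S0 => <-.
have YP : x0 |: H \in unmerged x0 H L S.
  rewrite in_unmerged eqxx andbT; apply/set0Pn; exists x0; exact: setU11.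
have LP y : y \in L -> L \in unmerged x0 H L S.
  by move=> yL; rewrite in_unmerged eqxx orbT andbT; apply/set0Pn; exists y.
have YS B : B \in S -> x0 |: H = B -> False.
  move=> BS e; have := setU11 x0 H; rewrite e => /(Sgt _ _ BS)[]; lia.
have LS B y : B \in S -> y \in L -> L = B -> False.
  by move=> BS yL e; have := yL; rewrite {1}e => /(Sgt _ _ BS)[_]; rewrite inE yL orbT.
apply/nc_partitionP; split.
- move=> B; rewrite inE in_set1 => /orP[/eqP->|BS].
    split; first by apply/set0Pn; exists x1.
    by move=> y /ge; rewrite inE.
  split; first by apply: contraNneq S0 => <-.
  by move=> y /(Sgt _ _ BS)[lt _]; rewrite inE ltnW.
- move=> x; rewrite inE => lex.
  have /cov[B] : x \in [set i : 'I_N | x0 <= i] by (rewrite inE; lia).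
  rewrite in_unmerged => /andP[_ /or3P[/eqP->|/eqP->|BS]] xB.
  + exists (H :|: L); first by rewrite setU11.
    move: xB; rewrite !inE => /orP[/eqP xx|->//].
    by move: lex; rewrite xx; lia.
  + by exists (H :|: L); rewrite ?setU11 // inE xB orbT.
  + by exists B => //; rewrite inE BS orbT.
- move=> A B x; rewrite inE in_set1 => /orP[/eqP->|AS];
    rewrite inE in_set1 => /orP[/eqP->|BS] // xA xB.
  + by case: (Sgt _ _ BS xB) => _ /negP[].
  + by case: (Sgt _ _ AS xA) => _ /negP[].
  + by apply: dis xA xB; apply: SP.
- move=> A B a b c d; rewrite inE in_set1 => /orP[/eqP->|AS];
    rewrite inE in_set1 => /orP[/eqP->|BS] // aA bB cA dB ab bc cd.
  + have [xb _] := Sgt _ _ BS bB.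
    case: (setUP cA) => [cH|cL].
      have x0b : x0 < b by apply: ltnW; rewrite -e10.
      case: (YS _ BS); apply: (nc _ _ x0 b c d) => //.
      * exact: SP.
      * exact: setU11.
      * exact: setU1r.
    case: (LS _ _ BS cL).
    apply: (nc _ _ x1 b c d) => //; [exact: LP cL|exact: SP|exact: low cL].
  + have [xa _] := Sgt _ _ AS aA.
    case: (setUP bB) => [bH|bL].
      have x0a : x0 < a by apply: ltnW; rewrite -e10.
      case: (YS _ AS); apply: (nc _ _ x0 a b c) => //.
      * exact: SP.
      * exact: setU11.
      * exact: setU1r.
    case: (LS _ _ AS bL).
    apply: (nc _ _ x1 a b c) => //; [exact: LP bL|exact: SP|exact: low bL].
  + by apply: (nc _ _ a b c d) => //; apply: SP.
Qed.

(** A crossing of [x0 |: H] with a block of [S] yields one of the merged block, with [x1] as lowest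
    point. The blocks [x0 |: H] and [L] do not cross, since [L] lies above [x0] and below [H]. *)
Lemma unmerged_nc N (x0 x1 : 'I_N) H L S : x1 = x0.+1 :> nat ->
  mergeable x1 H L S -> nc_partition [set i : 'I_N | x1 <= i] (merged H L S) ->
  nc_partition [set i : 'I_N | x0 <= i] (unmerged x0 H L S).
Proof.
move=> e10 [LH x1HL ge S0 Sgt] /nc_partitionP[sub cov dis nc].
have SQ B : B \in S -> B \in merged H L S by move=> BS; rewrite inE BS orbT.
have XQ : H :|: L \in merged H L S by rewrite setU11.
have XS B : B \in S -> H :|: L = B -> False.
  by move=> BS e; have := x1HL; rewrite {1}e => /(Sgt _ _ BS)[_]; rewrite x1HL.
have geH y : y \in H -> x0 < y.
  by move=> yH; have := ge y; rewrite inE yH => /(_ isT); lia.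
have geL y : y \in L -> x0 < y.
  by move=> yL; have := ge y; rewrite inE yL orbT => /(_ isT); lia.
have geS B y : B \in S -> y \in B -> x1 < y.
  by move=> BS yB; case: (Sgt _ _ BS yB).
have inY y : y \in x0 |: H -> x0 < y -> y \in H.
  by rewrite !inE => /orP[/eqP->|//]; rewrite ltnn.
have nS B y : B \in S -> y \in B -> y \in H :|: L -> False.
  by move=> BS yB; case: (Sgt _ _ BS yB) => _ /negP.
have HX y : y \in H -> y \in H :|: L by rewrite inE => ->.
have LX y : y \in L -> y \in H :|: L by rewrite inE orbC => ->.
apply/nc_partitionP; split.
- move=> B; rewrite in_unmerged => /andP[Bn0 BP]; split=> // y yB; rewrite inE.
  move: BP yB => /or3P[/eqP->|/eqP->|BS].
  + by rewrite !inE => /orP[/eqP->//|/geH/ltnW].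
  + by move/geL/ltnW.
  + by move/(geS _ _ BS); lia.
- move=> x; rewrite inE leq_eqVlt => /orP[/eqP e|lt].
    exists (x0 |: H); last by rewrite !inE -val_eqE /= e eqxx.
    by rewrite in_unmerged eqxx andbT; apply/set0Pn; exists x0; exact: setU11.
  have /cov[B] : x \in [set i : 'I_N | x1 <= i] by (rewrite inE; lia).
  rewrite inE in_set1 => /orP[/eqP->|BS] xB.
    case: (setUP xB) => [xH|xL].
      exists (x0 |: H); last exact: setU1r.
      by rewrite in_unmerged eqxx andbT; apply/set0Pn; exists x0; exact: setU11.
    by exists L => //; rewrite in_unmerged eqxx orbT andbT; apply/set0Pn; exists x.
  by exists B => //; rewrite in_unmerged BS !orbT andbT; apply/set0Pn; exists x.
- move=> A B x; rewrite !in_unmerged => /andP[_ AP] /andP[_ BP] xA xB.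
  move: AP BP xA xB => /or3P[/eqP->|/eqP->|AS] /or3P[/eqP->|/eqP->|BS] // xA xB.
  + have := LH x x xB (inY _ xA (geL _ xB)); lia.
  + case: (nS _ _ BS xB); apply/HX/inY => //; have := geS _ _ BS xB; lia.
  + have := LH x x xA (inY _ xB (geL _ xA)); lia.
  + by case: (nS _ _ BS xB); apply/LX.
  + case: (nS _ _ AS xA); apply/HX/inY => //; have := geS _ _ AS xA; lia.
  + by case: (nS _ _ AS xA); apply/LX.
  + by apply: dis xA xB; apply: SQ.
- move=> A B a b c d; rewrite !in_unmerged => /andP[_ AP] /andP[_ BP].
  move: AP BP => /or3P[/eqP->|/eqP->|AS] /or3P[/eqP->|/eqP->|BS] // aA bB cA dB ab bc cd.
  + have b0 := geL _ bB; have cH : c \in H by apply: inY => //; lia.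
    have := LH _ _ dB cH; lia.
  + have b0 := geS _ _ BS bB; have cH : c \in H by apply: inY => //; lia.
    by case: (XS _ BS); apply: (nc _ _ x1 b c d) => //; [exact: SQ|exact: HX].
  + have a0 := geL _ aA; have bH : b \in H by apply: inY => //; lia.
    have := LH _ _ cA bH; lia.
  + case: (XS _ BS); apply: (nc _ _ a b c d) => //; by [exact: SQ|exact: LX].
  + have a0 := geS _ _ AS aA; have bH : b \in H by apply: inY => //; lia.
    by case: (XS _ AS); apply: (nc _ _ x1 a b c) => //; [exact: SQ|exact: HX].
  + case: (XS _ AS); apply/esym.
    by apply: (nc _ _ a b c d) => //; [exact: SQ|exact: LX|exact: LX].
  + by apply: (nc _ _ a b c d) => //; apply: SQ.
Qed.

Lemma nc_unmerged N (x0 x1 : 'I_N) P : x1 = x0.+1 :> nat ->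
  nc_partition [set i : 'I_N | x0 <= i] P ->
  exists H L S, mergeable x1 H L S /\ P = unmerged x0 H L S.
Proof.
move=> e10 /nc_partitionP[sub cov dis nc].
have ge B y : B \in P -> y \in B -> x0 <= y.
  by move=> /sub[_ s] /s; rewrite inE.
have /cov[Y YP x0Y] : x0 \in [set i : 'I_N | x0 <= i] by rewrite inE.
have /cov[Z ZP x1Z] : x1 \in [set i : 'I_N | x0 <= i] by (rewrite inE; lia).
have YE : x0 |: Y :\ x0 = Y by rewrite setD1K.
have P0 : set0 \notin P by apply/negP => /sub[]; rewrite eqxx.
have gtY y : y \in Y :\ x0 -> x1 <= y.
  by rewrite !inE -val_eqE /= => /andP[ne /(ge _ _ YP)]; lia.
have gtB B y : B \in P -> B != Y -> y \in B -> x1 <= y.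
  move=> BP nBY yB; have := ge _ _ BP yB; rewrite leq_eqVlt e10 => /orP[/eqP e|//].
  have e' : x0 = y by apply: val_inj.
  by case/eqP: nBY; apply: dis yB _ => //; rewrite -e'.
have [x1Y|x1Y] := boolP (x1 \in Y).
  exists (Y :\ x0), set0, (P :\ Y); rewrite /mergeable setU0; split.
    split=> [l h|||| B y]; rewrite ?inE //.
    - by rewrite x1Y andbT -val_eqE /= e10; lia.
    - by rewrite (negPf P0) andbF.
    - case/andP => nBY BP yB; split; last first.
        apply/negP => /andP[_ yY]; case/eqP: nBY; exact: dis yB yY.
      have := gtB _ _ BP nBY yB; rewrite leq_eqVlt => /orP[/eqP e|//].
      have e' : x1 = y by apply: val_inj.
      by case/eqP: nBY; apply: dis yB _ => //; rewrite -e'.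
  apply/setP => B; rewrite in_unmerged YE !inE.
  case: (eqVneq B Y) => [->|nBY] /=.
    by rewrite YP andbT; apply/esym/set0Pn; exists x0.
  by case: eqVneq => [->|]; rewrite ?(negPf P0).
have nZY : Z != Y by apply: contraNneq x1Y => <-.
exists (Y :\ x0), Z, (P :\ Y :\ Z); split; last first.
  apply/setP => B; rewrite in_unmerged YE !inE.
  case: (eqVneq B Y) => [->|nBY] /=.
    by rewrite YP andbT; apply/esym/set0Pn; exists x0.
  case: (eqVneq B Z) => [->|nBZ] /=.
    by rewrite ZP andbT; apply/esym/set0Pn; exists x1.
  by case: eqVneq => [->|]; rewrite ?(negPf P0).
split=> [l h lZ hY||y||B y].
- move: (hY); rewrite !inE => /andP[_ hY'].
  rewrite ltnNge; apply/negP; rewrite leq_eqVlt => /orP[/eqP e|lt].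
    have e' : h = l by apply: val_inj.
    by case/eqP: nZY; apply: (dis _ _ l) => //; rewrite -e'.
  (* If [h] were below [l], then [x0 < x1 < h < l] would be a crossing. *)
  case/eqP: nZY; apply/esym; apply: (nc _ _ x0 x1 h l) => //; first by lia.
  have := gtY _ hY; rewrite leq_eqVlt => /orP[/eqP e|//].
  have e' : x1 = h by apply: val_inj.
  by rewrite e' hY' in x1Y.
- by rewrite inE x1Z orbT.
- by case/setUP => [/gtY|/(gtB _ _ ZP nZY)].
- by rewrite !inE (negPf P0) !andbF.
- rewrite !inE => /and3P[nBZ nBY BP] yB; split; last first.
    apply/negP => /orP[/andP[_ yY]|yZ].
      by case/eqP: nBY; exact: dis yB yY.
    by case/eqP: nBZ; exact: dis yB yZ.
  have := gtB _ _ BP nBY yB; rewrite leq_eqVlt => /orP[/eqP e|//].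
  have e' : x1 = y by apply: val_inj.
  by case/eqP: nBZ; apply: dis yB _ => //; rewrite -e'.
Qed.

Lemma nc_merged N (x1 : 'I_N) Q t :
  nc_partition [set i : 'I_N | x1 <= i] Q -> t <= #|pblock Q x1| ->
  exists H L S, [/\ mergeable x1 H L S, Q = merged H L S & #|H| = t].
Proof.
move=> ncQ; case/nc_partitionP: (ncQ) => sub cov dis nc.
have /cov[X XQ x1X] : x1 \in [set i : 'I_N | x1 <= i] by rewrite inE.
rewrite (nc_pblock ncQ XQ x1X) => /exists_last[H [HX cH LH]].
have XE : H :|: (X :\: H) = X by rewrite -[RHS](setID X H) (setIidPr HX).
exists H, (X :\: H), (Q :\ X); split=> //; last by rewrite /merged XE setD1K.
have Q0 : set0 \notin Q by apply/negP => /sub[]; rewrite eqxx.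
rewrite /mergeable XE; split=> //.
- by move=> y yX; case: (sub _ XQ) => _ /(_ _ yX); rewrite inE.
- by rewrite inE (negPf Q0) andbF.
- move=> B y; rewrite !inE => /andP[nBX BQ] yB; split; last first.
    by apply/negP => yX; case/eqP: nBX; exact: dis yB yX.
  case: (sub _ BQ) => _ /(_ _ yB); rewrite inE leq_eqVlt => /orP[/eqP e|//].
  have e' : x1 = y by apply: val_inj.
  by case/eqP: nBX; apply: dis yB _ => //; rewrite -e'.
Qed.

(** * Merging and splitting as inverse maps *)

Definition merge N (x0 x1 : 'I_N) (P : {set {set 'I_N}}) : {set {set 'I_N}} :=
  ((pblock P x0 :|: pblock P x1) :\ x0) |:
    [set B in P | (x0 \notin B) && (x1 \notin B)].

(** Inverse of [merge] on partitions whose block of [x0] has [t.+1] elements: the [t] largest points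
    of the block of [x1] join [x0], and the others, if any, form a block. *)
Definition split_first N (x0 x1 : 'I_N) (t : nat) (Q : {set {set 'I_N}}) :
    {set {set 'I_N}} :=
  let X := pblock Q x1 in
  unmerged x0 (lastn t X) (X :\: lastn t X) (Q :\ X).

Section Mergeable.

Variables (N : nat) (x0 x1 : 'I_N) (H L : {set 'I_N}) (S : {set {set 'I_N}}).
Hypotheses (e10 : x1 = x0.+1 :> nat) (M : mergeable x1 H L S).

Lemma mergeable_x0 : x0 \notin H :|: L.
Proof. by case: M => _ _ ge _ _; apply/negP => /ge; lia. Qed.

Lemma mergeable_disjoint : [disjoint H & L].
Proof.
case: M => LH _ _ _ _; apply/pred0Pn => -[y /andP[yH yL]].
by have := LH _ _ yL yH; rewrite ltnn.
Qed.

Lemma mergeable_notin (y : 'I_N) : y <= x1 -> forall B, B \in S -> y \notin B.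
Proof.
move=> le B BS; case: M => _ _ _ _ gt; apply/negP => /(gt _ _ BS)[]; lia.
Qed.

Hypothesis ncP : nc_partition [set i : 'I_N | x0 <= i] (unmerged x0 H L S).

Let ncQ : nc_partition [set i : 'I_N | x1 <= i] (merged H L S).
Proof. exact: merged_nc e10 M ncP. Qed.

Lemma unmerged_block : x0 |: H \in unmerged x0 H L S.
Proof.
rewrite in_unmerged eqxx andbT; apply/set0Pn; exists x0; exact: setU11.
Qed.

Lemma pblock_unmerged : pblock (unmerged x0 H L S) x0 = x0 |: H.
Proof. exact: nc_pblock ncP unmerged_block (setU11 _ _). Qed.

Lemma pblock_merged : pblock (merged H L S) x1 = H :|: L.
Proof. by apply: nc_pblock ncQ _ _; [exact: setU11 | case: M]. Qed.

Lemma card_pblock_unmerged : #|pblock (unmerged x0 H L S) x0| = #|H|.+1.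
Proof.
rewrite pblock_unmerged cardsU1; case: (boolP (x0 \in H)) => // xH.
by have := mergeable_x0; rewrite inE xH.
Qed.

Lemma card_pblock_merged : #|pblock (merged H L S) x1| = #|H| + #|L|.
Proof.
by rewrite pblock_merged cardsU disjoint_setI0 ?mergeable_disjoint // cards0 subn0.
Qed.

Lemma merge_unmerged : merge x0 x1 (unmerged x0 H L S) = merged H L S.
Proof.
have [_ x1HL _ S0 _] := M.
have [x0H x0L] : x0 \notin H /\ x0 \notin L.
  by apply/andP; rewrite -negb_or; have := mergeable_x0; rewrite inE.
rewrite /merge /merged; congr (_ |: _).
  have -> : (pblock (unmerged x0 H L S) x0 :|: pblock (unmerged x0 H L S) x1) =
      x0 |: (H :|: L).
    rewrite pblock_unmerged; case: (boolP (x1 \in L)) => x1L.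
      rewrite (nc_pblock (B := L) ncP) // ?setUA //.
      by rewrite in_unmerged eqxx orbT andbT; apply/set0Pn; exists x1.
    have x1H : x1 \in H by move: x1HL; rewrite inE (negPf x1L) orbF.
    rewrite (nc_pblock (B := x0 |: H) ncP) ?unmerged_block ?setU1r // setUid.
    have -> : L = set0.
      apply/eqP; apply: contraNT x1L => /set0Pn[y]; exact: mergeable_low M.
    by rewrite setU0.
  by rewrite setU1K // inE negb_or x0H.
apply/setP => B; rewrite inE in_unmerged.
apply/idP/idP => [/andP[/andP[B0 BP] /andP[x0B x1B]]|BS].
  case/or3P: BP => [/eqP BE|/eqP BE|//]; first by rewrite BE setU11 in x0B.
  case/set0Pn: B0 => y; rewrite BE in x1B *.
  by move/(mergeable_low M); rewrite (negPf x1B).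
rewrite BS !orbT !mergeable_notin ?e10 ?leqnSn ?andbT //.
by apply: contraNneq S0 => <-.
Qed.

Lemma split_merged : split_first x0 x1 #|H| (merged H L S) = unmerged x0 H L S.
Proof.
rewrite /split_first pblock_merged; case: (M) => LH x1HL _ _ _.
rewrite lastn_setU // setDUl setDv set0U (setDidPl _); last first.
  by rewrite disjoint_sym mergeable_disjoint.
rewrite /merged setU1K //; apply/negP => /(mergeable_notin (leqnn _)).
by rewrite x1HL.
Qed.

(** Splitting releases [L] as a block without [x0], whence the factor [w #|L|]; [w 0 = 1] covers an
    empty [L], which [unmerged] discards. *)
Lemma prod_unmerged w : w 0 = 1 ->
  \prod_(B in unmerged x0 H L S | x0 \notin B) w #|B| =
  w #|L| * \prod_(B in merged H L S | x1 \notin B) w #|B|.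
Proof.
move=> w0; have [_ x1HL _ S0 _] := M.
have x0L : x0 \notin L by have := mergeable_x0; rewrite inE negb_or => /andP[].
have -> : \prod_(B in merged H L S | x1 \notin B) w #|B| = \prod_(B in S) w #|B|.
  apply: eq_bigl => B; rewrite inE in_set1; case: eqP => [->|_] /=.
    rewrite x1HL; apply/esym/negP => /(mergeable_notin (leqnn _)).
    by rewrite x1HL.
  by case: (boolP (B \in S)) => //= BS; rewrite mergeable_notin.
have LS : L \notin S.
  apply/negP => LS; case: (set_0Vmem L) => [L0|[y yL]].
    by rewrite -L0 LS in S0.
  have := mergeable_notin (leqnn _) LS.
  by rewrite (mergeable_low M yL).
transitivity (\prod_(B in L |: S) w #|B|); last by rewrite big_setU1.
pose empty (B : {set 'I_N}) := B == set0.
rewrite (bigID empty) [RHS](bigID empty) /empty /=.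
rewrite big1 ?mul1n; last by move=> B /andP[_ /eqP->]; rewrite cards0.
rewrite [X in _ = X * _]big1 ?mul1n; last by move=> B /andP[_ /eqP->]; rewrite cards0.
apply: eq_bigl => B; rewrite in_unmerged inE in_set1.
case: eqP => //= _; rewrite ?andbT ?andbF //.
case: (eqVneq B (x0 |: H)) => [->|_] /=.
  rewrite setU11 /=; apply/esym/negP => /orP[/eqP e|].
    by rewrite -e setU11 in x0L.
  by move/(mergeable_notin (y := x0)); rewrite setU11 e10 leqnSn => /(_ isT).
case: eqP => [->|_] //=; case: (boolP (B \in S)) => //= BS.
by rewrite mergeable_notin ?e10.
Qed.

End Mergeable.

(** One step of the path, whose height is the size of the block of the least point. If [L] has [k]
    elements, the height goes from [t.+1] to [t + k] with weight [w k]. *)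
Lemma sum_nc_split N (x0 x1 : 'I_N) w t : x1 = x0.+1 :> nat -> w 0 = 1 ->
  \sum_(P | nc_partition [set i : 'I_N | x0 <= i] P && (#|pblock P x0| == t.+1))
     \prod_(B in P | x0 \notin B) w #|B| =
  \sum_(Q | nc_partition [set i : 'I_N | x1 <= i] Q && (t <= #|pblock Q x1|))
     w (#|pblock Q x1| - t) * \prod_(B in Q | x1 \notin B) w #|B|.
Proof.
move=> e10 w0.
rewrite (reindex_onto (split_first x0 x1 t) (merge x0 x1)) /=; last first.
  move=> P /andP[ncP /eqP cP].
  have [H [L [S [M EP]]]] := nc_unmerged e10 ncP.
  rewrite EP in ncP cP *; rewrite (merge_unmerged e10 M) //.
  move: cP; rewrite (card_pblock_unmerged e10 M) // => -[<-].
  exact: split_merged e10 M ncP.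
have condE Q : [&& nc_partition [set i : 'I_N | x0 <= i] (split_first x0 x1 t Q),
     #|pblock (split_first x0 x1 t Q) x0| == t.+1 &
     merge x0 x1 (split_first x0 x1 t Q) == Q] =
  nc_partition [set i : 'I_N | x1 <= i] Q && (t <= #|pblock Q x1|).
  apply/and3P/andP => [[ncP /eqP cP /eqP <-]|[ncQ le]].
    have [H [L [S [M EP]]]] := nc_unmerged e10 ncP.
    rewrite EP in ncP cP *; rewrite (merge_unmerged e10 M) //.
    split; first exact: merged_nc ncP.
    move: cP; rewrite (card_pblock_unmerged e10 M) // => -[<-].
    by rewrite (card_pblock_merged e10 M) // leq_addr.
  have [H [L [S [M EQ <-]]]] := nc_merged ncQ le.
  rewrite EQ in ncQ *; have ncP := unmerged_nc e10 M ncQ.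
  by rewrite (split_merged e10 M) // (card_pblock_unmerged e10 M) //
    (merge_unmerged e10 M).
apply: eq_big => [Q|Q]; first by rewrite -andbA condE.
rewrite -andbA condE => /andP[ncQ le].
have [H [L [S [M EQ cH]]]] := nc_merged ncQ le.
rewrite EQ in ncQ *; have ncP := unmerged_nc e10 M ncQ.
rewrite -cH (split_merged e10 M) // (card_pblock_merged e10 M) // addKn.
exact: (prod_unmerged e10 M).
Qed.

Lemma nc_pblock_gt0 N (x : 'I_N) P :
  nc_partition [set i : 'I_N | x <= i] P -> 0 < #|pblock P x| <= N - x.
Proof.
move=> ncP; case/nc_partitionP: (ncP) => sub cov _ _.
have /cov[B BP xB] : x \in [set i : 'I_N | x <= i] by rewrite inE.
rewrite (nc_pblock ncP BP xB); apply/andP; split.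
  by apply/card_gt0P; exists x.
have [_ s] := sub _ BP.
apply: (@leq_trans #|[set i : 'I_N | x <= i]|); first exact/subset_leq_card/subsetP.
rewrite -sum1_card (eq_bigl (fun i : 'I_N => x <= i)) => [|i]; last by rewrite inE.
rewrite -(big_mkord (fun i => x <= i) (fun=> 1)).
have := @big_nat_widenl _ 0 addn x 0 N xpredT (fun=> 1) isT.
by rewrite /= => <-; rewrite sum_nat_const_nat muln1.
Qed.

(** Each deleted point is one step. The last point left is a block of size 1, and the final step
    from 1 to 0 has weight [w 0 = 1]. *)
Lemma sum_nc_block N w (x : 'I_N) (L t : nat) : w 0 = 1 -> N - x = L.+1 ->
  \sum_(P | nc_partition [set i : 'I_N | x <= i] P && (#|pblock P x| == t))
     \prod_(B in P | x \notin B) w #|B| = passages w L.+1 t.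
Proof.
move=> w0; elim: L x t => [|L IH] x t eN.
  have eE : [set i : 'I_N | x <= i] = [set x].
    apply/setP => i; rewrite !inE -val_eqE /=.
    by have := ltn_ord i; lia.
  have pE P : nc_partition [set i : 'I_N | x <= i] P = (P == [set [set x]]).
    apply/nc_partitionP/eqP => [[sub cov dis nc]|->].
      have bE B : B \in P -> B = [set x].
        case/sub => B0 /subsetP; rewrite eE subset1 (negPf B0) orbF.
        by move/eqP.
      have /cov[B BP _] : x \in [set i : 'I_N | x <= i] by rewrite inE.
      apply/setP => C; rewrite inE; apply/idP/eqP => [/bE//|->].
      by rewrite -(bE _ BP).
    split=> [B|y|A B y|A B a b c d]; rewrite ?inE.
    - by move/eqP->; rewrite eE; split=> //; apply/set0Pn; exists x; rewrite inE.
    - move=> yx; exists [set x]; rewrite ?inE // -val_eqE /=.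
      by have := ltn_ord y; lia.
    - by move=> /eqP-> /eqP->.
    - by move=> /eqP-> /eqP->.
  transitivity (\sum_(P : {set {set 'I_N}} | (P == [set [set x]]) && (1 == t)) 1).
    apply: eq_big => P; rewrite pE; case: eqP => //= ->.
      rewrite (@nc_pblock _ [set i : 'I_N | x <= i] _ [set x]) ?pE ?inE //.
      by rewrite cards1.
    by move=> _; rewrite big1 // => B; rewrite !inE => /andP[/eqP->]; rewrite inE eqxx.
  case: t => [|t]; first by rewrite big_pred0 // => P; rewrite andbF.
  rewrite passagesS big_nat1 w0 mul1n addn0 eqSS.
  case: t => [|t]; last by rewrite big_pred0 // => P; rewrite andbF.
  by rewrite (big_pred1 [set [set x]]) // => P; rewrite andbT.
have lt : x.+1 < N by lia.
have [x1 e1] : exists x1 : 'I_N, x1 = x.+1 :> nat by exists (Ordinal lt).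
case: t => [|t].
  rewrite big_pred0 // => P; apply/negP => /andP[/nc_pblock_gt0/andP[gt0 _]].
  by rewrite -leqn0 leqNgt gt0.
rewrite (@sum_nc_split _ x x1) // passagesS.
pose G (Q : {set {set 'I_N}}) := \prod_(B in Q | x1 \notin B) w #|B|.
(* Partitions are sorted by the size [t + k] of the block of [x1]; only [L.+1] points remain, so
   [k <= L.+1]. *)
transitivity (\sum_(0 <= k < L.+2)
   \sum_(Q | nc_partition [set i : 'I_N | x1 <= i] Q && (#|pblock Q x1| == t + k))
      w k * G Q).
  rewrite (exchange_big_dep (fun Q => nc_partition [set i : 'I_N | x1 <= i] Q
    && (t <= #|pblock Q x1|))) /=; last first.
    by move=> k Q _ /andP[-> /eqP->]; rewrite leq_addr.
  apply: eq_bigr => Q /andP[ncQ le].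
  have /andP[_ leN] := nc_pblock_gt0 ncQ.
  rewrite ncQ /= (eq_bigl (fun k => k == #|pblock Q x1| - t)); last first.
    by move=> k; rewrite -[in RHS](eqn_add2l t) subnKC // eq_sym.
  rewrite big_mkord (big_pred1 (inord (#|pblock Q x1| - t))) ?inordK //.
  - by rewrite ltnS; move: leN; rewrite /=; lia.
  - move=> k; rewrite /= -val_eqE /= inordK //.
    by rewrite ltnS; move: leN; rewrite /=; lia.
apply: eq_bigr => k _; rewrite -big_distrr IH //=; lia.
Qed.

(** The first step leads from 1 to the size of the block of the first point and carries its weight,
    which [sum_nc_block] leaves out. *)
Lemma sum_nc_partitions N w : w 0 = 1 ->
  \sum_(P | nc_partition [set: 'I_N] P) \prod_(B in P) w #|B| = passages w N.+1 1.
Proof.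
move=> w0; case: N => [|N].
  rewrite passagesS big_nat1 muln1 w0 (big_pred1 set0).
    by rewrite big_set0.
  move=> P; rewrite /=; apply/nc_partitionP/eqP => [[sub _ _ _]|->].
    apply/setP => B; rewrite !inE; apply/negP => /sub[/set0Pn[[]]] //.
  split=> [B|[]|A B x|A B a b c d] //; by rewrite inE.
have [x0 x00] : exists x0 : 'I_N.+1, x0 = 0 :> nat by exists ord0.
have eT : [set: 'I_N.+1] = [set i : 'I_N.+1 | x0 <= i].
  by apply/setP => i; rewrite !inE x00.
rewrite eT passagesS.
transitivity (\sum_(0 <= k < N.+2)
   \sum_(P | nc_partition [set i : 'I_N.+1 | x0 <= i] P && (#|pblock P x0| == k))
      w k * \prod_(B in P | x0 \notin B) w #|B|).
  rewrite (exchange_big_dep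
    (fun P => nc_partition [set i : 'I_N.+1 | x0 <= i] P)) /=; last first.
    by move=> k Q _ /andP[].
  apply: eq_bigr => P ncP.
  have leN : #|pblock P x0| < N.+2.
    by have /andP[_] := nc_pblock_gt0 ncP; rewrite x00 subn0.
  rewrite ncP /= (eq_bigl (fun k => k == #|pblock P x0|)); last first.
    by move=> k; rewrite eq_sym.
  rewrite big_mkord (big_pred1 (inord #|pblock P x0|)) ?inordK //; last first.
    by move=> k; rewrite /= -val_eqE /= inordK.
  case/nc_partitionP: (ncP) => _ cov dis _.
  have /cov[Y YP Y0] : x0 \in [set i : 'I_N.+1 | x0 <= i] by rewrite inE.
  rewrite (nc_pblock ncP YP Y0) (bigD1 Y) //=; congr (_ * _).
  apply: eq_bigl => B; case: (boolP (B \in P)) => //= BP.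
  case: eqP => [->|ne]; first by rewrite Y0.
  by apply/esym/negP => B0; case: ne; exact: dis B0 Y0.
apply: eq_bigr => k _; rewrite -big_distrr (@sum_nc_block _ _ _ N) //.
by rewrite x00 subn0.
Qed.

(** * Convex polygons *)

Local Open Scope ring_scope.

Lemma convex_set_comb (R : realType) (C : classical_sets.set 'rV[R]_2) x y (t : R) :
  convex_set C -> 0 <= t -> t <= 1 -> C x -> C y -> C (t *: x + (1 - t) *: y).
Proof.
move=> cC t0 t1 Cx Cy.
have := cC x y (Itv01 t0 t1); rewrite !in_setE => /(_ Cx Cy).
by [].
Qed.

Lemma convex_set_of_comb (R : realType) (C : classical_sets.set 'rV[R]_2) :
  (forall x y (t : R), 0 <= t -> t <= 1 -> C x -> C y -> C (t *: x + (1 - t) *: y)) ->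
  convex_set C.
Proof.
move=> cC x y l; rewrite !in_setE => Cx Cy.
by apply: (cC x y l%:num).
Qed.

Lemma orientation_comb (R : realType) (a b x y : 'rV[R]_2) (t : R) :
  orientation a b (t *: x + (1 - t) *: y) =
  t * orientation a b x + (1 - t) * orientation a b y.
Proof. rewrite /orientation !mxE; ring. Qed.

Lemma orientation_rot (R : realType) (a b c : 'rV[R]_2) :
  orientation a b c = orientation b c a.
Proof. rewrite /orientation; ring. Qed.

Lemma orientation_swap (R : realType) (a b c : 'rV[R]_2) :
  orientation a b c = - orientation a c b.
Proof. rewrite /orientation; ring. Qed.

Lemma orientation_Plucker (R : realType) (o a b c e : 'rV[R]_2) :
  orientation o e b * orientation o a c =
  orientation o e a * orientation o b c + orientation o e c * orientation o a b.
Proof. rewrite /orientation; ring. Qed.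

Lemma orientation_eq0 (R : realType) (a b : 'rV[R]_2) :
  orientation a b a = 0 /\ orientation a b b = 0.
Proof. rewrite /orientation; split; ring. Qed.

(** Four points of the plane satisfy an affine relation whose coefficients are, up to sign, the
    areas of the triangles omitting one of them. With the signs assumed, it exhibits a common point
    of the segments from [a] to [c] and from [b] to [d]. *)
Lemma crossing_hulls_meet (R : realType) (s : R) (A B : classical_sets.set 'rV[R]_2)
    (a b c d : 'rV[R]_2) : A a -> A c -> B b -> B d ->
  0 < s * orientation b c d -> 0 < s * orientation a c d ->
  0 < s * orientation a b d -> 0 < s * orientation a b c ->
  (convex_hull A `&` convex_hull B !=set0)%classic.
Proof.
move=> Aa Ac Bb Bd; set la := _ * _; set lb := _ * _; set lc := _ * _.
set ld := _ * _ => la0 lb0 lc0 ld0.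
have e0 : la + lc = lb + ld.
  rewrite /la /lb /lc /ld /orientation; ring.
have hull (C : classical_sets.set 'rV[R]_2) x y p q : C x -> C y -> 0 < p -> 0 < q ->
    convex_hull C ((p + q)^-1 *: (p *: x + q *: y)).
  move=> Cx Cy p0 q0 M [cM CM].
  have pq : 0 < p + q by rewrite addr_gt0.
  have -> : (p + q)^-1 *: (p *: x + q *: y) =
      (p / (p + q)) *: x + (1 - p / (p + q)) *: y.
    rewrite scalerDr !scalerA mulrC; congr (_ + _ *: _).
    by field; rewrite gt_eqF.
  apply: convex_set_comb => //; [|  |exact: CM|exact: CM].
    by rewrite divr_ge0 ?ltW.
  by rewrite ler_pdivrMr // mul1r lerDl ltW.
exists ((la + lc)^-1 *: (la *: a + lc *: c)); split; first exact: hull.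
have -> : la *: a + lc *: c = lb *: b + ld *: d.
  apply/rowP => i; rewrite !mxE /la /lb /lc /ld /orientation.
  have [->|->] : i = 0 \/ i = 1.
    by case: i => [[|[|]]] //= ?; [left|right]; apply: val_inj.
    by ring.
  by ring.
by rewrite e0; exact: hull.
Qed.

(** An open half-plane and its closed complement are convex, so each contains the hull on its side.
    Points of [B] may lie on the line, as two of them will in the application. *)
Lemma halfplanes_hulls_disjoint (R : realType) (s : R) (p q : 'rV[R]_2)
    (A B : classical_sets.set 'rV[R]_2) :
  (forall x, A x -> 0 < s * orientation p q x) ->
  (forall x, B x -> s * orientation p q x <= 0) ->
  (convex_hull A `&` convex_hull B = classical_sets.set0)%classic.
Proof.
move=> pA pB; apply/seteqP; split=> // x [xA xB]; exfalso.
have : 0 < s * orientation p q x.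
  apply: (xA [set x | 0 < s * orientation p q x]%classic); split=> //.
  apply: convex_set_of_comb => y z t t0 t1 /= fy fz.
  rewrite orientation_comb mulrDr mulrCA [s * (_ * _)]mulrCA.
  have [->|tn0] := eqVneq t 0; first by rewrite mul0r add0r subr0 mul1r.
  apply: ltr_pwDl; last by rewrite mulr_ge0 ?subr_ge0 // ltW.
  by rewrite mulr_gt0 // lt_neqAle eq_sym tn0.
apply/negP; rewrite -leNgt.
apply: (xB [set x | s * orientation p q x <= 0]%classic); split=> //.
apply: convex_set_of_comb => y z t t0 t1 /= fy fz.
rewrite orientation_comb mulrDr mulrCA [s * (_ * _)]mulrCA.
have t1' : 0 <= 1 - t by rewrite subr_ge0.
by have := mulr_ge0_le0 t0 fy; have := mulr_ge0_le0 t1' fz; lra.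
Qed.

(** The sign [s] records the sense in which [v] runs around the polygon. All sides share it, and the
    Plücker relation extends it from the sides to all increasing triples. *)
Lemma convex_polygon_orientation (R : realType) (N : nat) (v : 'I_N -> 'rV[R]_2) :
  convex_polygon v -> exists s : R, forall i j k : 'I_N, (i < j)%N -> (j < k)%N ->
    0 < s * orientation (v i) (v j) (v k).
Proof.
move=> [_ hv]; have [N2|N3] := leqP N 2.
  exists 1 => i j k; have := ltn_ord k; lia.
pose side (s : R) (i : 'I_N) := forall k : 'I_N, k != i -> k != ordS i ->
  0 < s * orientation (v i) (v (ordS i)) (v k).
have sides i : exists2 s : R, s = 1 \/ s = -1 & side s i.
  case: (hv i) => h; [exists 1; first by left | exists (-1); first by right].
    by move=> k k1 k2; rewrite mul1r h.
  by move=> k k1 k2; rewrite mulN1r oppr_gt0 h.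
have ordS_val (i : 'I_N) : ordS i = (if i.+1 == N then 0 else i.+1)%N :> nat.
  rewrite /=; case: eqP => [->|ne]; first by rewrite modnn.
  by rewrite modn_small //; have := ltn_ord i; lia.
have neq (x y : 'I_N) : x <> y :> nat -> x != y.
  by move=> h; apply/eqP => e; apply: h; rewrite e.
(* Consecutive sides have the same sign, as both can be tested on the triangle of [i] and its next
   two vertices. *)
have next s i : s = 1 \/ s = -1 -> side s i -> side s (ordS i).
  move=> s1 hs; have [s' s1' hs'] := sides (ordS i).
  have ne1 : ordS (ordS i) != i.
    apply: neq; rewrite !ordS_val; have := ltn_ord i.
    by case: eqP; case: eqP; lia.
  have ne2 : ordS (ordS i) != ordS i.
    apply: neq; rewrite ordS_val; have := ltn_ord (ordS i).
    by case: eqP; lia.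
  have ne3 : i != ordS i.
    apply: neq; rewrite ordS_val; have := ltn_ord i.
    by case: eqP; lia.
  have h1 := hs _ ne1 ne2.
  have := hs' i ne3; rewrite eq_sym ne1 -orientation_rot => /(_ isT) h2.
  suff -> : s = s' by [].
  by case: s1 s1' h1 h2 => [->|->] [->|->] //; rewrite mul1r mulN1r; lra.
have N0 : (0 < N)%N by lia.
have [s s1 hs0] := sides (Ordinal N0).
have hs : forall k (lt : (k < N)%N), side s (Ordinal lt).
  elim=> [|k IH] lt.
    by have -> : Ordinal lt = Ordinal N0 by apply: val_inj.
  have -> : Ordinal lt = ordS (Ordinal (ltnW lt)).
    by apply: ord_inj; rewrite ordS_val /=; case: eqP => // ?; lia.
  exact: next.
have {}hs i : side s i by case: i => k lt; apply: hs.
have ordS_lt (i j : 'I_N) : (i < j)%N -> ordS i = i.+1 :> nat.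
  by move=> ij; rewrite ordS_val; have := ltn_ord j; case: eqP => //; lia.
exists s => i j k ij jk.
(* Induction on [k] through a bound [m]. If [j] follows [i] or [k] follows [j], the triple contains
   a side; otherwise [k] is compared with its predecessor. *)
have [m le] : exists m, (k <= m)%N by exists k.
elim: m k jk le => [|m IH] k jk lek; first by lia.
have sidei (l : 'I_N) : (ordS i < l)%N -> 0 < s * orientation (v i) (v (ordS i)) (v l).
  move=> lt; have e := ordS_lt _ _ ij; apply: hs; rewrite -val_eqE /=.
    by lia.
  by apply/eqP => e'; rewrite e' ltnn in lt.
have [ej|nej] := eqVneq j (ordS i).
  by rewrite ej; apply: sidei; rewrite -ej.
have eS := ordS_lt _ _ ij.
have ltj : (ordS i < j)%N.
  rewrite eS ltn_neqAle ij andbT; apply/eqP => e; case/eqP: nej.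
  by apply: ord_inj; rewrite eS.
have [ek|nek] := eqVneq (k : nat) j.+1.
  have -> : k = ordS j by apply: ord_inj; rewrite (ordS_lt _ _ jk).
  rewrite orientation_rot; apply: hs; first by rewrite -val_eqE /=; lia.
  by apply: neq; rewrite (ordS_lt _ _ jk); lia.
have ltk : (k.-1 < N)%N by have := ltn_ord k; lia.
pose k' := Ordinal ltk.
have ek' : k = ordS k'.
  by apply: ord_inj; rewrite (ordS_lt k' k) /=; lia.
have p1 : 0 < s * orientation (v i) (v j) (v k') by (apply: IH => /=; lia).
have p2 : 0 < s * orientation (v i) (v k') (v k).
  rewrite orientation_rot ek'; apply: hs; first by rewrite -val_eqE /=; lia.
  by rewrite -ek' -val_eqE /=; lia.
have p3 : 0 < s * orientation (v i) (v (ordS i)) (v j) by apply: sidei.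
have p4 : 0 < s * orientation (v i) (v (ordS i)) (v k').
  by apply: sidei; rewrite eS /=; lia.
have p5 : 0 < s * orientation (v i) (v (ordS i)) (v k) by (apply: sidei; lia).
(* The relation writes a positive multiple of the wanted orientation as a sum of two positive
   products. *)
have key := orientation_Plucker (v i) (v j) (v k') (v k) (v (ordS i)).
rewrite -(pmulr_rgt0 _ p4) mulrACA key mulrDr -mulrACA -[X in _ + X]mulrACA.
exact: addr_gt0 (mulr_gt0 p3 p2) (mulr_gt0 p5 p1).
Qed.

Lemma hulls_disjoint_noncrossing (R : realType) (N : nat) (v : 'I_N -> 'rV[R]_2)
    (P : {set {set 'I_N}}) :
  convex_polygon v -> finset.partition P [set: 'I_N] ->
  (forall B, B \in P -> (1 < #|B|)%N) ->
  hulls_disjoint v P <-> noncrossing P.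
Proof.
move=> /convex_polygon_orientation[s hs] /and3P[_ /finset.trivIsetP tri P0] P2.
have dis A B x : A \in P -> B \in P -> A != B -> x \in A -> x \in B -> False.
  move=> AP BP AB xA xB; have /pred0P/(_ x) := tri _ _ AP BP AB.
  by rewrite /= xA xB.
split=> [hd A B a b c d AP BP aA bB cA dB ab bc cd|nc A B AP BP AB].
  have [//|AB] := eqVneq A B; exfalso.
  have [x] : (convex_hull (v @` [set` A]) `&` convex_hull (v @` [set` B]) !=set0)%classic.
    apply: (@crossing_hulls_meet _ s _ _ (v a) (v b) (v c) (v d));
      first [by [exists a|exists b|exists c|exists d] | by apply: hs => //; lia].
  by rewrite (hd _ _ AP BP AB).
(* If [A'] has a point [a] before all of [B'], the line through the first and last points [b], [c]
   of [B'] separates the blocks: a point [x] of [A'] between them would give the crossing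
   [a < b < x < c]. Blocks of at least two points ensure [b < c]. *)
have half : forall (A' B' : {set 'I_N}) (a : 'I_N), A' \in P -> B' \in P -> A' != B' ->
    a \in A' -> (forall y, y \in B' -> (a < y)%N) ->
    (convex_hull (v @` [set` A']) `&` convex_hull (v @` [set` B']) =
       classical_sets.set0)%classic.
  move=> {A B AP BP AB} A B a AP BP AB aA aB.
  have /card_gt0P[b0 b0B] : (0 < #|B|)%N by apply: ltn_trans (P2 _ BP).
  case: (@arg_minnP _ b0 (fun y => y \in B) (fun y => y) b0B) => b bB bmin.
  case: (@arg_maxnP _ b0 (fun y => y \in B) (fun y => y) b0B) => c cB cmax.
  have bc : (b < c)%N.
    rewrite ltn_neqAle bmin // andbT; apply/negP => /eqP e.
    suff : (#|B| <= #|[set b]|)%N by rewrite cards1 leqNgt P2.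
    apply/subset_leq_card/subsetP => y yB; rewrite inE -val_eqE /=.
    by have := bmin y yB; have := cmax y yB; rewrite /=; lia.
  apply: (@halfplanes_hulls_disjoint _ s (v b) (v c)) => _ [x xS <-].
    have xA : x \in A by exact: xS.
    have nb : x <> b by move=> e; apply: (dis _ _ x AP BP AB xA); rewrite e.
    have nc' : x <> c by move=> e; apply: (dis _ _ x AP BP AB xA); rewrite e.
    have [xb|bx] := ltnP x b; first by rewrite -orientation_rot; exact: hs.
    have {}bx : (b < x)%N.
      by rewrite ltn_neqAle bx andbT; apply/eqP => e; apply: nb; exact: val_inj.
    have [xc|cx] := ltnP x c.
      case/eqP: AB; apply: (nc _ _ a b x c) => //; exact: aB.
    have {}cx : (c < x)%N.
      by rewrite ltn_neqAle cx andbT; apply/eqP => e; apply: nc'; exact: val_inj.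
    exact: hs.
  have xB : x \in B by exact: xS.
  have [e1 e2] := orientation_eq0 (v b) (v c).
  have [->|nb] := eqVneq x b; first by rewrite e1 mulr0.
  have [->|nc'] := eqVneq x c; first by rewrite e2 mulr0.
  rewrite orientation_swap mulrN oppr_le0 ltW //; apply: hs.
    by have := bmin x xB; move: nb; rewrite -val_eqE /=; lia.
  by have := cmax x xB; move: nc'; rewrite -val_eqE /=; lia.
have /card_gt0P[a0 a0A] : (0 < #|A|)%N by apply: ltn_trans (P2 _ AP).
have /card_gt0P[b0 b0B] : (0 < #|B|)%N by apply: ltn_trans (P2 _ BP).
case: (@arg_minnP _ a0 (fun y => y \in A) (fun y => y) a0A) => a aA amin.
case: (@arg_minnP _ b0 (fun y => y \in B) (fun y => y) b0B) => b bB bmin.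
case: (ltngtP a b) => ab.
- by apply: (half A B a) => // y /bmin /=; lia.
- rewrite classical_sets.setIC; apply: (half B A b) => //; first by rewrite eq_sym.
  by move=> y /amin /=; lia.
- by case: (dis _ _ a AP BP AB aA); rewrite (val_inj ab).
Qed.

(** * Cardinalities *)

Lemma card_coloured_dyck_coef m n :
  (2 * n).+1%:R * #|coloured_dyck m n|%:R =
  ((\poly_(k < m.+1) (1 : rat)) ^+ (2 * n).+1)`_n.
Proof.
set phi := \poly_(k < m.+1) _.
(* Passages of [n.+1] steps only involve coefficients up to [n], so the generating series may be
   truncated. *)
pose p : {poly rat} := \poly_(k < n.+1) #|restricted_dyck m k|%:R.
have n0 : n.+1%:R != 0 :> rat by rewrite pnatr_eq0.
(* The first application of the formula gives [[t^n] p^(n+1)], the number of first passages from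
   [n + 1] in time [2n + 1]. The second brings a factor [n + 1], matching the one introduced
   here. *)
apply: (mulfI n0); rewrite card_coloured_dyck mulrCA.
rewrite (@passages_coef _ _ p) // => [|k ltk]; last by rewrite coef_poly ltk.
rewrite mul1r subn1 (@coef_exp_passages _ (fun i => (i <= m)%N) p n) //; last first.
  by move=> k lek; rewrite coef_poly ltnS lek card_restricted_dyck.
rewrite /= (_ : (n + n.+1 = (2 * n).+1)%N); last by lia.
rewrite (@passages_coef _ _ phi) => [|k _|]; last by lia.
  by congr (_ * _`_ _); lia.
by rewrite coef_poly ltnS; case: leqP.
Qed.

Lemma card_polygon_partition (R : realType) m n (v : 'I_(2 * n) -> 'rV[R]_2) :
  convex_polygon v ->
  #|polygon_partition m v| =
  passages (fun k => ~~ odd k && (k <= 2 * m)%N) (2 * n).+1 1.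
Proof.
move=> hv; rewrite -sum_nc_partitions // card_sig -sum1_card.
rewrite [LHS](eq_bigl (fun P : {set {set 'I_(2 * n)}} =>
   nc_partition [set: 'I_(2 * n)] P &&
   [forall B in P, ~~ odd #|B| && (#|B| <= 2 * m)%N])); last first.
  move=> P; rewrite inE /nc_partition.
  case: (boolP (finset.partition P _)) => //= partP; rewrite andbC.
  case: (boolP [forall B in P, _]) => [/forall_inP ev|]; last by rewrite !andbF.
  rewrite !andbT; apply: asbool_equiv_eq.
  apply: hulls_disjoint_noncrossing => // B BP.
  (* A nonempty block of even size has at least two points, as the geometric criterion requires. *)
  have /andP[odB _] := ev _ BP.
  have B0 : B != set0 by apply: contraTneq BP => ->; case/and3P: partP.
  by move: B0 odB; rewrite -card_gt0; case: #|B| => [|[]].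
rewrite big_mkcondr /=; apply: eq_bigr => P _.
case: (boolP [forall B in P, _]) => [/forall_inP ev|].
  by rewrite big1 // => B BP; rewrite ev.
case/forall_inPn => B BP /negPf evB.
by rewrite (bigD1 B) //= evB mul0n.
Qed.

Lemma card_polygon_partition_coef (R : realType) m n
    (v : 'I_(2 * n) -> 'rV[R]_2) : convex_polygon v ->
  (2 * n).+1%:R * #|polygon_partition m v|%:R =
  ((\poly_(k < m.+1) (1 : rat)) ^+ (2 * n).+1)`_n.
Proof.
move=> hv; rewrite card_polygon_partition //; set phi := \poly_(k < m.+1) _.
rewrite (@passages_coef _ _ (phi \Po 'X^2)) // => [|k _].
  rewrite mul1r subn1 -rmorphXn /= coef_comp_poly_Xn // dvdn_mulr //.
  by rewrite mulKn.
rewrite coef_comp_poly_Xn // dvdn2 coef_poly ltnS.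
case: (boolP (odd k)) => //= ev.
rewrite -{2}(odd_double_half k) (negPf ev) divn2 -mul2n leq_pmul2l //.
by case: leqP.
Qed.

Lemma eq_card_bijective (T T' : finType) :
  #|T| = #|T'| -> exists f : T -> T', bijective f.
Proof.
move=> e; have cast_bij : bijective (cast_ord e).
  by exists (cast_ord (esym e)); [exact: cast_ordK | exact: cast_ordKV].
exists (fun x => enum_val (cast_ord e (enum_rank x))).
exact: bij_comp (@enum_val_bij T') (bij_comp cast_bij (@enum_rank_bij T)).
Qed.

Theorem theorem2 (R : realType) (m n : nat) (v : 'I_(2 * n) -> 'rV[R]_2)
  (hm : (1 <= m)%N) (hv : convex_polygon v) :
  (exists f : coloured_dyck m n -> polygon_partition m v, bijective f) /\
  ((1 <= n)%N ->
    let c : rat :=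
      \sum_(0 <= p < `|Num.ceil (n%:R / m%:R : rat)|)
        (-1) ^+ p / (n - m * p)%:R * ('C(n - m * p, p))%:R
          * ('C(3 * n - m * p - p, n - m * p - 1))%:R in
    #|coloured_dyck m n|%:R = c /\ #|polygon_partition m v|%:R = c).
Proof.
have nz : (2 * n).+1%:R != 0 :> rat by rewrite pnatr_eq0.
have eD := card_coloured_dyck_coef m n.
have eP := card_polygon_partition_coef m hv.
split.
  (* Both cardinalities times [2n + 1] are the same coefficient, and this factor cancels in
     [rat]. *)
  apply: eq_card_bijective; apply/eqP; rewrite -(eqr_nat rat).
  by apply/eqP/(mulfI nz); rewrite eD eP.
move=> n1 c; have eC := coef_exp_geometric_sum hm n1.
by split; apply: (mulfI nz); rewrite ?eD ?eP eC.
Qed.
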